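(* Let $\Sigma_V,\Sigma_E$ be label sets and $\alpha:\Sigma_V\cup\Sigma_E\to(0,+\infty)$. Let $G$ be the set of graphs with vertex labels in $\Sigma_V$ and edge labels in $\Sigma_E$, where isomorphic graphs are regarded as the same element of $G$. Let $\subseteq$ be the subgraph-isomorphic relation on $G$, and define $s_{GVE\alpha}:G\to[0,\infty)$ by $s_{GVE\alpha}(g)=0$ if $V=\emptyset$ and otherwise $s_{GVE\alpha}(g)=\sum_{v\in V}\alpha(\ell_V(v))+\sum_{e\in E}\alpha(\ell_E(e))$ for $g=(V,E,\ell_V,\ell_E)$. Then $(G,\subseteq,s_{GVE\alpha})$ is a Maximum Common Subelement (MCS) Model.
   Context: A graph is a 4-tuple $g=(V,E,\ell_V,\ell_E)$ with $V$ a finite set, $E\subseteq[V]^2$ (the set of 2-element subsets of $V$), $\ell_V:V\to\Sigma_V$, $\ell_E:E\to\Sigma_E$; it is empty if $V=\emptyset$. $g'=(V',E',\ell'_V,\ell'_E)$ is a subgraph of $g$ if $V'\subseteq V$, $E'\subseteq E\cap[V']^2$, and $\ell'_V,\ell'_E$ agree with $\ell_V,\ell_E$ on $V',E'$. An isomorphism between $g_1$ and $g_2$ is a bijection $\phi:V_1\to V_2$ with $E_2=\{\{\phi(u),\phi(v)\}:\{u,v\}\in E_1\}$ preserving vertex and edge labels. $g'\subseteq g$ means some subgraph of $g$ is isomorphic to $g'$. For a partial order $\preccurlyeq$ on $X$ and $X'\subseteq X$, $cs(X')=\{x\in X: x\preccurlyeq y\ \forall y\in X'\}$. A size function on $(X,\preccurlyeq)$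 is $s:X\to[0,\infty)$ with (S1) $x_1\preccurlyeq x_2\Rightarrow s(x_1)\le s(x_2)$ and (S2) $x_1\preccurlyeq x_2$, $s(x_1)=s(x_2)\Rightarrow x_1=x_2$. An MCS Model is a triple $(X,\preccurlyeq,s)$ with $\preccurlyeq$ a partial order on $X$, $s$ a size function, and (A1) for all $x_1,x_2$, $cs(\{x_1,x_2\})\ne\emptyset$ and $\{s(x)\mid x\in cs(\{x_1,x_2\})\}$ has a maximum; (A2) for all $x_1,x_2,x$ with $x_1,x_2\preccurlyeq x$ there is $x_{12}\in cs(\{x_1,x_2\})$ with $s(x)\ge s(x_1)+s(x_2)-s(x_{12})$. *)

(* Defs.v *)
From HB Require Import structures.
From mathcomp Require Import all_boot all_order all_algebra.
From mathcomp Require Import all_classical reals.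

Set Implicit Arguments.
Unset Strict Implicit.
Unset Printing Implicit Defensive.

Import Order.TTheory GRing.Theory Num.Theory.
Local Open Scope classical_set_scope.
Local Open Scope ring_scope.

(* Subsets of [X] are plain predicates here: [X] will be a type of isomorphism
   classes of graphs on arbitrary finite types, too large for the universe of
   the [classical_sets] operations. *)
Definition common_subelements (X : Type) (le : X -> X -> Prop)
    (X' : X -> Prop) (x : X) : Prop := forall y, X' y -> le x y.

Definition pair_of (X : Type) (x1 x2 y : X) : Prop := y = x1 \/ y = x2.

Record is_size_function (R : realType) (X : Type) (le : X -> X -> Prop)
    (s : X -> R) : Prop := IsSizeFunction {
  size_function_ge0 : forall x, 0 <= s x;
  size_function_mono : forall x1 x2, le x1 x2 -> s x1 <= s x2;
  size_function_strict : forall x1 x2, le x1 x2 -> s x1 = s x2 -> x1 = x2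
}.

Definition has_maximum (R : realType) (A : set R) : Prop :=
  exists2 m, A m & ubound A m.

Record is_MCS_model (R : realType) (X : Type) (le : X -> X -> Prop)
    (s : X -> R) : Prop := IsMCSModel {
  MCS_order : Relation_Definitions.order X le;
  MCS_size : is_size_function le s;
  MCS_A1 : forall x1 x2,
    (exists x, common_subelements le (pair_of x1 x2) x) /\
    has_maximum
      [set r | exists2 x, common_subelements le (pair_of x1 x2) x & s x = r];
  MCS_A2 : forall x1 x2 x, le x1 x -> le x2 x ->
    exists2 x12, common_subelements le (pair_of x1 x2) x12 &
                 s x >= s x1 + s x2 - s x12
}.

Definition two_subsets (T : finType) (A : {set T}) : {set {set T}} :=
  [set e in powerset A | #|e| == 2%N].

(* The two label sets are subsets of a common type [L], so that they may
   overlap and a single weight function can be defined on their union. *)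
Record lgraph (L : Type) (SV SE : set L) := LGraph {
  vertex : finType;
  edges : {set {set vertex}};
  edges_sub : edges \subset two_subsets [set: vertex]%SET;
  vlabel : vertex -> SV;
  elabel : {e : {set vertex} | e \in edges} -> SE
}.

Section Graphs.
Variables (L : Type) (SV SE : set L).
Local Notation graph := (lgraph SV SE).
Implicit Types g h : graph.

Definition is_isomorphism g1 g2 (phi : vertex g1 -> vertex g2) : Prop :=
  [/\ bijective phi,
      edges g2 = [set phi @: e | e : {set vertex g1} in edges g1]%SET,
      forall v, vlabel (phi v) = vlabel v &
      forall (e1 : {e | e \in edges g1}) (e2 : {e | e \in edges g2}),
        val e2 = (phi @: val e1)%SET -> elabel e2 = elabel e1].

Definition isomorphic g1 g2 : Prop :=
  exists phi : vertex g1 -> vertex g2, is_isomorphism phi.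

(* The labels of a subgraph are forced, so it is given by its vertex and edge
   sets; [graph_of] turns it into a graph in its own right. *)
Record subgraph g := Subgraph {
  sub_vertices : {set vertex g};
  sub_edges : {set {set vertex g}};
  sub_edgesP : sub_edges \subset edges g :&: two_subsets sub_vertices
}.

Section GraphOf.
Variables (g : graph) (h : subgraph g).

Let V' : finType := {v : vertex g | v \in sub_vertices h}.

Definition sub_graph_edges : {set {set V'}} :=
  [set e : {set V'} | (val @: e)%SET \in sub_edges h]%SET.

Lemma sub_graph_edges_sub : sub_graph_edges \subset two_subsets [set: V']%SET.
Proof.
apply/fintype.subsetP => e; rewrite !inE => he; apply/andP; split.
  exact: finset.subsetT.
have /fintype.subsetP/(_ _ he) := sub_edgesP h.
by rewrite !inE => /andP[_ /andP[_]]; rewrite card_imset //; exact: val_inj.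
Qed.

Lemma sub_graph_edge (e : {e : {set V'} | e \in sub_graph_edges}) :
  (val @: val e)%SET \in edges g.
Proof.
case: e => e /=; rewrite inE => he.
by have /fintype.subsetP/(_ _ he) := sub_edgesP h; rewrite inE => /andP[].
Qed.

Definition graph_of : graph :=
  LGraph sub_graph_edges_sub (fun v : V' => vlabel (val v))
    (fun e => elabel (exist (fun e => is_true (e \in edges g))
      (val @: val e)%SET (sub_graph_edge e))).

End GraphOf.

Definition subgraph_isomorphic g' g : Prop :=
  exists h : subgraph g, isomorphic (graph_of h) g'.

Section Size.
Variables (R : realType) (alpha : L -> R).

Definition size_GVE g : R :=
  if #|vertex g| == 0%N then 0
  else \sum_(v : vertex g) alpha (val (vlabel v)) +
       \sum_(e : {e | e \in edges g}) alpha (val (elabel e)).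

End Size.

Lemma isomorphic_refl g : isomorphic g g.
Proof.
exists id; split => //; first by exists id.
  by apply/finset.setP => e; rewrite (eq_imset _ (@imset_id _)) imset_id.
move=> e1 e2; rewrite imset_id => /val_inj -> //.
Qed.

Lemma is_isomorphism_edge g1 g2 (phi : vertex g1 -> vertex g2) :
  is_isomorphism phi -> forall e : {e | e \in edges g1},
  (phi @: val e)%SET \in edges g2.
Proof. by move=> [_ hE _ _] e; rewrite hE imset_f //; exact: valP. Qed.

Lemma isomorphic_sym g1 g2 : isomorphic g1 g2 -> isomorphic g2 g1.
Proof.
move=> [phi [[psi phiK psiK] hE hV hL]].
have psi_imK : cancel (fun e : {set vertex g1} => phi @: e)%SET
                      (fun e => psi @: e)%SET.
  by move=> e; rewrite -imset_comp -[RHS]imset_id; apply: eq_imset => x /=.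
have phi_imK : cancel (fun e : {set vertex g2} => psi @: e)%SET
                      (fun e => phi @: e)%SET.
  by move=> e; rewrite -imset_comp -[RHS]imset_id; apply: eq_imset => x /=.
exists psi; split; first by exists phi.
- rewrite hE -imset_comp -[LHS]imset_id; apply: eq_imset => e /=.
  by rewrite psi_imK.
- by move=> v; rewrite -hV psiK.
- by move=> e1 e2 h; apply/esym/hL; rewrite h phi_imK.
Qed.

Lemma isomorphic_trans g2 g1 g3 :
  isomorphic g1 g2 -> isomorphic g2 g3 -> isomorphic g1 g3.
Proof.
move=> [p pP] [q qP]; have pE := is_isomorphism_edge pP.
case: pP qP => [pb pE' pV pL] [qb qE' qV qL]; exists (q \o p); split.
- exact: bij_comp.
- by rewrite qE' pE' -imset_comp; apply: eq_imset => e /=; rewrite imset_comp.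
- by move=> v /=; rewrite qV pV.
- move=> e1 e3 h; pose e2 : {e | e \in edges g2} := exist (fun e => is_true (e \in edges g2)) _ (pE e1).
  rewrite -(pL e1 e2 erefl); apply: qL.
  by rewrite h imset_comp.
Qed.

Lemma subgraph_isomorphic_iso g1 g2 h1 h2 :
  isomorphic g1 h1 -> isomorphic g2 h2 ->
  subgraph_isomorphic g1 g2 -> subgraph_isomorphic h1 h2.
Proof.
move=> i1 [phi [phib hE hV hL]] [k ki].
have phi_inj := bij_inj phib.
have kP : ([set phi @: e | e : {set _} in sub_edges k] \subset
           edges h2 :&: two_subsets (phi @: sub_vertices k))%SET.
  apply/fintype.subsetP => _ /imsetP[e ek ->].
  have /fintype.subsetP/(_ _ ek) := sub_edgesP k.
  rewrite !inE => /andP[eE /andP[eV e2]].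
  by rewrite hE imset_f //= imsetS // card_imset.
exists (Subgraph kP); apply: isomorphic_trans i1.
apply: isomorphic_trans ki; apply: isomorphic_sym.
have phiV (v : {v | v \in sub_vertices k}) :
    phi (val v) \in (phi @: sub_vertices k)%SET by apply: imset_f; exact: valP.
have surj (w : {v | v \in (phi @: sub_vertices k)%SET}) :
    exists v : {v | v \in sub_vertices k}, phi (val v) == val w.
  case: w => w /= /imsetP[v vk ->]; by exists (exist (fun v => is_true (v \in _)) v vk) => /=.
pose f (v : {v | v \in sub_vertices k}) :
  {v | v \in (phi @: sub_vertices k)%SET} :=
  exist (fun v => is_true (v \in (phi @: sub_vertices k)%SET)) _ (phiV v).
have fb : bijective f.
  exists (fun w => xchoose (surj w)).
    move=> v; apply/val_inj/phi_inj; exact/eqP/(xchooseP (surj (f v))).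
  by move=> w; apply/val_inj; exact/eqP/(xchooseP (surj w)).
have valf (e : {set {v | v \in sub_vertices k}}) :
    (val @: (f @: e) = phi @: (val @: e))%SET.
  by rewrite -!imset_comp; apply: eq_imset.
have phis_inj := imset_inj phi_inj.
exists (f : vertex (graph_of k) -> vertex (graph_of (Subgraph kP))); split=> //.
- have [f' fK f'K] := fb.
  apply/finset.setP => e; rewrite inE /=; apply/idP/imsetP.
    have eE : e = (f @: (f' @: e))%SET.
      by rewrite -imset_comp -[LHS]imset_id; apply: eq_imset => x /=.
    move=> he; exists (f' @: e)%SET => //; rewrite inE.
    by move: he; rewrite {1}eE valf mem_imset.
  by move=> [e']; rewrite inE => he' ->; rewrite valf mem_imset.
- by move=> v /=; exact: hV.
- move=> e1 e2 h /=; apply: hL => /=.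
  by rewrite h valf.
Qed.

Lemma size_GVE_iso (R : realType) (alpha : L -> R) g1 g2 :
  isomorphic g1 g2 -> size_GVE alpha g1 = size_GVE alpha g2.
Proof.
move=> [phi phiP]; have pE := is_isomorphism_edge phiP.
case: phiP => phib hE hV hL; rewrite /size_GVE.
rewrite -(bij_eq_card phib); case: ifP => // _; congr (_ + _).
  rewrite [RHS](reindex phi) /=; last exact: onW_bij.
  by apply: eq_bigr => v _; rewrite hV.
have phis_inj := imset_inj (bij_inj phib).
pose f (e : {e | e \in edges g1}) : {e | e \in edges g2} := exist (fun e => is_true (e \in edges g2)) _ (pE e).
have surj (w : {e | e \in edges g2}) : exists e, f e == w.
  case: w => w wE.
  have /imsetP[e ee we] : w \in [set phi @: e | e : {set vertex g1} in edges g1]%SET.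
    by rewrite -hE.
  by exists (exist (fun e => is_true (e \in _)) e ee); apply/eqP/val_inj.
have fb : bijective f.
  exists (fun w => xchoose (surj w)).
    move=> e; apply/val_inj/phis_inj.
    exact/(congr1 val (eqP (xchooseP (surj (f e))))).
  by move=> w; exact/eqP/(xchooseP (surj w)).
rewrite [RHS](reindex f) /=; last exact: onW_bij.
by apply: eq_bigr => e _; congr (alpha (val _)); exact/esym/hL.
Qed.

(* An isomorphism class is the predicate of belonging to it. *)
Record graph_class := GraphClass {
  members : graph -> Prop;
  membersP : exists g, members = isomorphic g
}.

Definition class_of g : graph_class :=
  GraphClass (ex_intro (fun g' => isomorphic g = isomorphic g') g erefl).

Definition representative (C : graph_class) : graph := projT1 (cid (membersP C)).

(* The relation and the size are read off representatives; by [subclassE] and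
   [size_classE] they do not depend on the choice. *)
Definition subclass (C D : graph_class) : Prop :=
  subgraph_isomorphic (representative C) (representative D).

Definition size_class (R : realType) (alpha : L -> R) (C : graph_class) : R :=
  size_GVE alpha (representative C).

Lemma members_inj C D : members C = members D -> C = D.
Proof.
case: C D => [P hP] [Q hQ] /= hPQ; case: _ / hPQ hQ => hQ.
by congr GraphClass; exact: Prop_irrelevance.
Qed.

Lemma class_of_eq g1 g2 : class_of g1 = class_of g2 <-> isomorphic g1 g2.
Proof.
split => [/(congr1 (@members)) /= ->|h]; first exact: isomorphic_refl.
apply: members_inj; apply/funext => g; apply/propext; split.
  exact/isomorphic_trans/isomorphic_sym.
exact: isomorphic_trans.
Qed.

Lemma representativeK C : class_of (representative C) = C.
Proof. by apply: members_inj; rewrite /representative; case: cid. Qed.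

Lemma representative_class_of g : isomorphic (representative (class_of g)) g.
Proof. by apply/class_of_eq; exact: representativeK. Qed.

Lemma subclassE g1 g2 :
  subclass (class_of g1) (class_of g2) <-> subgraph_isomorphic g1 g2.
Proof.
have h1 := representative_class_of g1; have h2 := representative_class_of g2.
split; apply: subgraph_isomorphic_iso => //; exact: isomorphic_sym.
Qed.

Lemma size_classE (R : realType) (alpha : L -> R) g :
  size_class alpha (class_of g) = size_GVE alpha g.
Proof. exact/size_GVE_iso/representative_class_of. Qed.

End Graphs.

(* Main.v *)
(* Up to isomorphism, [g' <= g] means that [g'] embeds into [g], and the size
   of the subgraph of [g] with vertex set [V] and edge set [E] is a modular,
   strictly monotone function of the pair [(V, E)].  Strict monotonicity gives
   (S2), and hence antisymmetry.  A common subelement of [x1] and [x2] has the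
   size of one of the finitely many pairs [(V, E)] in [x1], whence the maximum
   in (A1).  For (A2), [x12] is the intersection of the two subgraphs of [x],
   and [s x] is at least the size of their union. *)
Require Import Defs.
From mathcomp Require Import all_boot all_order all_algebra.
From mathcomp Require Import all_classical reals.

Set Implicit Arguments.
Unset Strict Implicit.
Unset Printing Implicit Defensive.

Import Order.TTheory GRing.Theory Num.Theory.
Local Open Scope classical_set_scope.
Local Open Scope ring_scope.

(** * Sums over finite sets: modularity and strict monotonicity *)

Section SetSums.
Variables (R : realType) (T : finType) (f : T -> R).
Implicit Types A B : {set T}.

Lemma sum_setUI A B :
  \sum_(x in A :|: B) f x + \sum_(x in A :&: B) f x =
  \sum_(x in A) f x + \sum_(x in B) f x.
Proof.
rewrite (big_setID B) /= finset.setIC finset.setKU.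
rewrite finset.setDUl finset.setDv finset.setU0.
by rewrite [\sum_(x in A) _](big_setID B) /= -addrA addrC [X in X + _]addrC.
Qed.

Lemma ler_sum_subset A B : (forall x, x \in B -> 0 <= f x) -> A \subset B ->
  \sum_(x in A) f x <= \sum_(x in B) f x.
Proof.
move=> f_ge0 sAB; rewrite [leRHS](big_setID A) /=.
rewrite (finset.setIidPr sAB) lerDl.
by apply: sumr_ge0 => x; rewrite inE => /andP[_ /f_ge0].
Qed.

(** The sum over [B :\: A] is at most 0 while its terms are positive, so [B :\: A] is empty. *)
Lemma sum_subset_inj A B : (forall x, x \in B -> 0 < f x) -> A \subset B ->
  \sum_(x in B) f x <= \sum_(x in A) f x -> A = B.
Proof.
move=> f_gt0 sAB; rewrite (big_setID A) /= (finset.setIidPr sAB) gerDl => le0.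
have f_ge0 x : x \in B :\: A -> 0 <= f x.
  by rewrite inE => /andP[_ /f_gt0 /ltW].
have sum0 : \sum_(x in B :\: A) f x = 0.
  by apply/eqP; rewrite eq_le le0 sumr_ge0.
apply/eqP; rewrite finset.eqEsubset sAB; apply/fintype.subsetP => x xB.
apply: contraT => xA; have xBA : x \in B :\: A by rewrite inE xA.
by have := f_gt0 x xB; rewrite (psumr_eq0P f_ge0 sum0 xBA) ltxx.
Qed.

End SetSums.

(** * Embeddings as a description of the subgraph relation *)

Section Embeddings.
Variables (L : Type) (SV SE : set L).
Local Notation graph := (lgraph SV SE).
Implicit Types g : graph.

(** Edges must go to edges but not conversely, because subgraphs need not be induced. For maps,
    transitivity is composition; for subgraphs it would nest sigma types. *)
Definition is_embedding g1 g2 (phi : vertex g1 -> vertex g2) : Prop :=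
  [/\ injective phi,
      forall e : {set vertex g1}, e \in edges g1 -> (phi @: e)%SET \in edges g2,
      forall v, vlabel (phi v) = vlabel v &
      forall (e1 : {e | e \in edges g1}) (e2 : {e | e \in edges g2}),
        val e2 = (phi @: val e1)%SET -> elabel e2 = elabel e1].

Lemma embedding_id g : is_embedding (@id (vertex g)).
Proof.
split=> // [e|e1 e2]; first by rewrite imset_id.
by rewrite imset_id => /val_inj ->.
Qed.

Lemma embedding_comp g1 g2 g3 (p : vertex g1 -> vertex g2)
    (q : vertex g2 -> vertex g3) :
  is_embedding p -> is_embedding q -> is_embedding (q \o p).
Proof.
move=> [pI pE pV pL] [qI qE qV qL]; split.
- exact: inj_comp.
- by move=> e /pE /qE; rewrite imset_comp.
- by move=> v /=; rewrite qV pV.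
- move=> e1 e3 h.
  pose e2 : {e | e \in edges g2} :=
    exist (fun e => is_true (e \in edges g2)) _ (pE _ (valP e1)).
  by rewrite -(pL e1 e2 erefl); apply: qL; rewrite h imset_comp.
Qed.

Lemma isomorphism_embedding g1 g2 (phi : vertex g1 -> vertex g2) :
  is_isomorphism phi -> is_embedding phi.
Proof.
move=> [phib hE hV hL]; split=> // [|e eE]; first exact: bij_inj.
by rewrite hE imset_f.
Qed.

(** An injection into a finite type that is no larger is bijective, and the other inclusion of edge
    sets is part of being an embedding. *)
Lemma embedding_isomorphism g1 g2 (phi : vertex g1 -> vertex g2) :
  is_embedding phi -> (#|vertex g2| <= #|vertex g1|)%N ->
  edges g2 \subset [set phi @: e | e : {set vertex g1} in edges g1]%SET ->
  is_isomorphism phi.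
Proof.
move=> [phiI hE hV hL] card_le sE; split=> //; first exact: inj_card_bij.
apply/eqP; rewrite finset.eqEsubset sE /=.
by apply/fintype.subsetP => _ /imsetP[e eE ->]; exact: hE.
Qed.

Lemma embedding_graph_of g (h : subgraph g) :
  is_embedding (val : vertex (graph_of h) -> vertex g).
Proof.
split=> // [e eE|].
  exact: (sub_graph_edge (exist (fun e => is_true (e \in _)) e eE)).
by move=> e1 e2 h12 /=; congr elabel; apply: val_inj.
Qed.

Lemma sub_edges_imset g (h : subgraph g) :
  sub_edges h = [set val @: e | e : {set _} in edges (graph_of h)]%SET.
Proof.
apply/finset.setP => e.
apply/idP/imsetP => [eh|[e']]; last by rewrite inE => ? ->.
have /fintype.subsetP/(_ _ eh) := sub_edgesP h.
rewrite !inE => /andP[_ /andP[/fintype.subsetP eV _]].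
(* The ends of [e] lie in [sub_vertices h], so [e] is the image under [val] of its own preimage. *)
have eE : e = (val @: (val @^-1: e : {set vertex (graph_of h)}))%SET.
  apply/finset.setP => v.
  apply/idP/imsetP => [ve|[w]]; last by rewrite inE => ? ->.
  by exists (exist (fun v => is_true (v \in _)) v (eV v ve)); rewrite ?inE.
by exists (val @^-1: e)%SET => //; rewrite inE -eE.
Qed.

(** Factorization of [phi] through the inclusion [val]. It serves to compare an embedding with its
    image, and two subgraphs of one graph with each other. *)
Lemma embedding_into_graph_of g' g (h : subgraph g)
    (phi : vertex g' -> vertex g) :
  is_embedding phi -> (forall v, phi v \in sub_vertices h) ->
  (forall e : {set vertex g'},
     e \in edges g' -> (phi @: e)%SET \in sub_edges h) ->
  exists2 psi : vertex g' -> vertex (graph_of h),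
    is_embedding psi & forall v, val (psi v) = phi v.
Proof.
move=> [phiI hE hV hL] phiV phiE.
pose psi v : vertex (graph_of h) :=
  exist (fun v => is_true (v \in sub_vertices h)) _ (phiV v).
have val_psi (e : {set vertex g'}) : (val @: (psi @: e) = phi @: e)%SET.
  by rewrite -imset_comp; apply: eq_imset.
exists psi => //; split.
- by move=> u v /(congr1 val)/phiI.
- by move=> e eE; rewrite inE val_psi phiE.
- by move=> v; rewrite -hV.
- by move=> e1 e2 h12; apply: hL; rewrite /= h12 val_psi.
Qed.

Lemma subgraph_isomorphicP g' g :
  subgraph_isomorphic g' g <->
  exists phi : vertex g' -> vertex g, is_embedding phi.
Proof.
split=> [[h /isomorphic_sym[phi /isomorphism_embedding phiP]]|[phi phiP]].
  by exists (val \o phi); apply: embedding_comp (embedding_graph_of h).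
have [phiI hE _ _] := phiP.
(* The subgraph sought is the image of [phi]; edges keep two elements because [phi] is injective. *)
have hP : [set phi @: e | e : {set vertex g'} in edges g']%SET \subset
    edges g :&: two_subsets (phi @: [set: vertex g'])%SET.
  apply/fintype.subsetP => _ /imsetP[e eE ->].
  have /fintype.subsetP/(_ _ eE) := edges_sub g'.
  by rewrite !inE hE // imsetS ?finset.subsetT // card_imset // => /andP[].
have [||psi psiP psiE] := embedding_into_graph_of (h := Subgraph hP) phiP.
- by move=> v; rewrite imset_f.
- by move=> e eE; rewrite imset_f.
exists (Subgraph hP); apply: isomorphic_sym; exists psi.
apply: embedding_isomorphism => //.
  by rewrite card_sig card_imset // cardsT.
apply/fintype.subsetP => e; rewrite inE => /imsetP[e' e'E ee'].
apply/imsetP; exists e' => //; apply: (imset_inj val_inj).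
by rewrite ee' -imset_comp; apply: eq_imset => v /=; rewrite psiE.
Qed.

Lemma subgraph_isomorphic_refl g : subgraph_isomorphic g g.
Proof. by apply/subgraph_isomorphicP; exists id; exact: embedding_id. Qed.

Lemma subgraph_isomorphic_trans g1 g2 g3 :
  subgraph_isomorphic g1 g2 -> subgraph_isomorphic g2 g3 ->
  subgraph_isomorphic g1 g3.
Proof.
move=> /subgraph_isomorphicP[p pP] /subgraph_isomorphicP[q qP].
apply/subgraph_isomorphicP; exists (q \o p); exact: embedding_comp.
Qed.

Lemma graph_of_subgraph_isomorphic g (h : subgraph g) :
  subgraph_isomorphic (graph_of h) g.
Proof. by exists h; exact: isomorphic_refl. Qed.

Lemma graph_of_mono g (h1 h2 : subgraph g) :
  sub_vertices h1 \subset sub_vertices h2 -> sub_edges h1 \subset sub_edges h2 ->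
  subgraph_isomorphic (graph_of h1) (graph_of h2).
Proof.
move=> /fintype.subsetP sV /fintype.subsetP sE; apply/subgraph_isomorphicP.
have [||psi psiP _] :=
    embedding_into_graph_of (h := h2) (embedding_graph_of h1).
- by move=> v; apply/sV/valP.
- by move=> e; rewrite inE => /sE.
by exists psi.
Qed.

Lemma graph_of_full g (h : subgraph g) :
  sub_vertices h = [set: vertex g]%SET -> sub_edges h = edges g ->
  isomorphic (graph_of h) g.
Proof.
move=> hV hE; exists val; apply: embedding_isomorphism.
- exact: embedding_graph_of.
- by rewrite card_sig hV cardsT.
by rewrite -hE sub_edges_imset.
Qed.

(** The empty graph is a common subelement of any two graphs, as (A1) demands. Taken as a subgraph
    of [g], it inherits its label functions. *)
Lemma exists_subgraph_empty g :
  exists h : subgraph g, forall g', subgraph_isomorphic (graph_of h) g'.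
Proof.
have hP : finset.set0 \subset edges g :&: two_subsets finset.set0.
  exact: finset.sub0set.
exists (Subgraph hP) => g'; apply/subgraph_isomorphicP.
have F (v : vertex (graph_of (Subgraph hP))) : False.
  by case: v => v /=; rewrite inE.
have FE (e : {set vertex (graph_of (Subgraph hP))}) :
  e \notin edges (graph_of (Subgraph hP)) by rewrite !inE.
exists (fun v => False_rect _ (F v)); split.
- by move=> v; case: (F v).
- by move=> e; rewrite (negbTE (FE e)).
- by move=> v; case: (F v).
- by case=> e eE; have := FE e; rewrite eE.
Qed.

(** * Weights of pairs of a vertex set and an edge set *)

Section Weights.
Variables (R : realType) (alpha : L -> R).
Hypothesis alpha_gt0 : forall l : L, (SV `|` SE) l -> 0 < alpha l.

Definition vertex_weight g (v : vertex g) : R := alpha (val (vlabel v)).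

(** The default 0 outside [edges g] makes the weight total, so that sums range over plain sets of
    sets instead of a sigma type that changes with the graph. *)
Definition edge_weight g (e : {set vertex g}) : R :=
  if insub e is Some e' then alpha (val (elabel (e' : {e | e \in edges g})))
  else 0.

Definition weight g (V : {set vertex g}) (E : {set {set vertex g}}) : R :=
  \sum_(v in V) vertex_weight v + \sum_(e in E) edge_weight e.

Lemma vertex_weight_gt0 g (v : vertex g) : 0 < vertex_weight v.
Proof. by apply: alpha_gt0; left; exact: set_valP. Qed.

Lemma edge_weight_gt0 g (e : {set vertex g}) :
  e \in edges g -> 0 < edge_weight e.
Proof.
by move=> eE; rewrite /edge_weight insubT; apply: alpha_gt0; right; exact: set_valP.
Qed.

Lemma edge_weightE g (e : {e | e \in edges g}) :
  edge_weight (val e) = alpha (val (elabel e)).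
Proof. by rewrite /edge_weight valK. Qed.

Lemma edge_weight_graph_of g (h : subgraph g)
    (e : {set vertex (graph_of h)}) :
  e \in edges (graph_of h) -> edge_weight e = edge_weight (val @: e)%SET.
Proof.
move=> eE; pose e1 : {e | e \in edges (graph_of h)} :=
  exist (fun e => is_true (e \in _)) e eE.
pose e2 : {e | e \in edges g} :=
  exist (fun e => is_true (e \in edges g)) _ (sub_graph_edge e1).
by rewrite -[e]/(val e1) edge_weightE -[(val @: _)%SET]/(val e2) edge_weightE.
Qed.

Lemma size_GVE_weight g :
  size_GVE alpha g = weight [set: vertex g]%SET (edges g).
Proof.
have -> : weight [set: vertex g]%SET (edges g) =
    \sum_(v : vertex g) alpha (val (vlabel v)) +
    \sum_(e : {e | e \in edges g}) alpha (val (elabel e)).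
  rewrite /weight; congr (_ + _).
    by apply: eq_bigl => v; rewrite inE.
  by rewrite big_sub; apply: eq_bigr => e _; exact: edge_weightE.
(* Without vertices there are no edges, as an edge has two elements; both sums are then empty and
   agree with the value 0 of the empty graph. *)
rewrite /size_GVE; case: ifP => // /eqP/card0_eq V0.
rewrite big_pred0 // big_pred0 ?addr0 // => -[e eE].
have /fintype.subsetP/(_ _ eE) := edges_sub g.
rewrite inE => /andP[_ /cards2P[u _]]; have := V0 u.
by rewrite !inE.
Qed.

Lemma size_GVE_graph_of g (h : subgraph g) :
  size_GVE alpha (graph_of h) = weight (sub_vertices h) (sub_edges h).
Proof.
rewrite size_GVE_weight /weight; congr (_ + _).
  by rewrite [RHS]big_sub; apply: eq_bigl => v; rewrite inE.
rewrite (eq_bigr _ (@edge_weight_graph_of g h)).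
(* Reindexing along the injection sending [e] to [val @: e], whose image is [sub_edges h]. *)
rewrite -(big_imset _ (in2W (imset_inj val_inj))) /=.
by rewrite [in RHS]sub_edges_imset.
Qed.

Lemma weight_le g (V : {set vertex g}) (E : {set {set vertex g}}) :
  E \subset edges g -> weight V E <= size_GVE alpha g.
Proof.
move=> sE; rewrite size_GVE_weight lerD //; apply: ler_sum_subset => //.
- by move=> v _; exact/ltW/vertex_weight_gt0.
- by move=> e /edge_weight_gt0/ltW.
Qed.

(** Each of the two sums is bounded by its full counterpart. Since the totals agree, the bound on
    one sum gives the reverse bound on the other. *)
Lemma weight_inj g (V : {set vertex g}) (E : {set {set vertex g}}) :
  E \subset edges g -> weight V E = size_GVE alpha g ->
  V = [set: vertex g]%SET /\ E = edges g.
Proof.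
move=> sE; rewrite size_GVE_weight /weight => wE.
have sV := finset.subsetT V.
have v_gt0 v : v \in [set: vertex g]%SET -> 0 < vertex_weight v.
  by move=> _; exact: vertex_weight_gt0.
have leV := ler_sum_subset (fun v vV => ltW (v_gt0 v vV)) sV.
have leE := ler_sum_subset (fun e eE => ltW (edge_weight_gt0 eE)) sE.
split; [apply: (sum_subset_inj v_gt0 sV)|
        apply: (sum_subset_inj (@edge_weight_gt0 g) sE)].
  by rewrite -(lerD2r (\sum_(e in E) edge_weight e)) wE lerD2l.
by rewrite -(lerD2l (\sum_(v in V) vertex_weight v)) wE lerD2r.
Qed.

Lemma weight_setUI g (V1 V2 : {set vertex g}) (E1 E2 : {set {set vertex g}}) :
  weight (V1 :|: V2) (E1 :|: E2) + weight (V1 :&: V2) (E1 :&: E2) =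
  weight V1 E1 + weight V2 E2.
Proof. by rewrite /weight addrACA !sum_setUI addrACA. Qed.

Lemma sub_edges_edges g (h : subgraph g) : sub_edges h \subset edges g.
Proof. exact: fintype.subset_trans (sub_edgesP h) (finset.subsetIl _ _). Qed.

Lemma size_GVE_ge0 g : 0 <= size_GVE alpha g.
Proof.
apply: le_trans (weight_le finset.set0 (finset.sub0set (edges g))).
by rewrite /weight !finset.big_set0 addr0.
Qed.

Lemma size_GVE_mono g' g :
  subgraph_isomorphic g' g -> size_GVE alpha g' <= size_GVE alpha g.
Proof.
move=> [h /(size_GVE_iso alpha) <-].
by rewrite size_GVE_graph_of weight_le ?sub_edges_edges.
Qed.

Lemma size_GVE_strict g' g :
  subgraph_isomorphic g' g -> size_GVE alpha g' = size_GVE alpha g ->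
  isomorphic g' g.
Proof.
move=> [h hg']; rewrite -(size_GVE_iso alpha hg') size_GVE_graph_of.
move=> /(weight_inj (sub_edges_edges h))[hV hE].
exact: isomorphic_trans (isomorphic_sym hg') (graph_of_full hV hE).
Qed.

Lemma subgraph_isomorphic_intersection g1 g2 g :
  subgraph_isomorphic g1 g -> subgraph_isomorphic g2 g ->
  exists g12, [/\ subgraph_isomorphic g12 g1, subgraph_isomorphic g12 g2 &
    size_GVE alpha g1 + size_GVE alpha g2 <=
    size_GVE alpha g + size_GVE alpha g12].
Proof.
move=> [h1 i1] [h2 i2].
pose V := sub_vertices h1 :&: sub_vertices h2.
pose E := sub_edges h1 :&: sub_edges h2.
have hP : E \subset edges g :&: two_subsets V.
  apply/fintype.subsetP => e; rewrite inE => /andP[e1 e2].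
  have /fintype.subsetP/(_ _ e1) := sub_edgesP h1.
  have /fintype.subsetP/(_ _ e2) := sub_edgesP h2.
  rewrite !inE finset.subsetI => /andP[_ /andP[-> _]].
  by move=> /andP[-> /andP[-> ->]].
exists (graph_of (Subgraph hP)); split.
- apply: subgraph_isomorphic_iso (isomorphic_refl _) i1 _.
  by apply: graph_of_mono; exact: finset.subsetIl.
- apply: subgraph_isomorphic_iso (isomorphic_refl _) i2 _.
  by apply: graph_of_mono; exact: finset.subsetIr.
rewrite -(size_GVE_iso alpha i1) -(size_GVE_iso alpha i2) !size_GVE_graph_of.
(* Modularity leaves the weight of the union to be bounded. The union is not made into a graph:
   [weight_le] only asks that its edges be edges of [g]. *)
by rewrite -weight_setUI lerD2r weight_le // finset.subUset !sub_edges_edges.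
Qed.

(** Every element of [A] is the weight of a pair from a finite type, so a pair of largest weight,
    among those whose weight lies in [A], gives the maximum. *)
Lemma size_has_maximum g (A : set R) :
  A !=set0 ->
  (forall r, A r -> exists2 g', subgraph_isomorphic g' g & size_GVE alpha g' = r) ->
  has_maximum A.
Proof.
move=> [r0 Ar0] hA.
have wA r : A r -> exists VE : {set vertex g} * {set {set vertex g}},
    weight VE.1 VE.2 = r.
  move=> /hA[g' [h /(size_GVE_iso alpha) hg'] <-].
  by exists (sub_vertices h, sub_edges h); rewrite -hg' size_GVE_graph_of.
have [VE0 w0] := wA _ Ar0.
pose P := fun VE : {set vertex g} * {set {set vertex g}} =>
  `[< A (weight VE.1 VE.2) >].
have P0 : P VE0 by apply/asboolP; rewrite w0.
have [VE /asboolP AVE maxVE] :=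
  arg_maxP (fun VE : {set vertex g} * {set {set vertex g}} => weight VE.1 VE.2) P0.
exists (weight VE.1 VE.2) => // r Ar; have [VE' w'] := wA _ Ar.
by rewrite -w'; apply: maxVE; apply/asboolP; rewrite w'.
Qed.

End Weights.
End Embeddings.

(** * The model axioms on isomorphism classes *)

Theorem theorem2 (R : realType) (L : Type) (SV SE : set L) (alpha : L -> R)
    (alpha_gt0 : forall l : L, (SV `|` SE) l -> 0 < alpha l) :
  is_MCS_model (@subclass L SV SE) (@size_class L SV SE R alpha).
Proof.
have strict (x1 x2 : graph_class SV SE) : subclass x1 x2 ->
    size_class alpha x1 = size_class alpha x2 -> x1 = x2.
  move=> le12 /(size_GVE_strict alpha_gt0 le12)/class_of_eq.
  by rewrite !representativeK.
have mono (x1 x2 : graph_class SV SE) : subclass x1 x2 ->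
  size_class alpha x1 <= size_class alpha x2 by exact: size_GVE_mono.
have subl (g : lgraph SV SE) (x : graph_class SV SE) :
    subgraph_isomorphic g (representative x) -> subclass (class_of g) x.
  by rewrite -[x in subclass _ x]representativeK => /subclassE.
split.
- split.
  + by move=> x; exact: subgraph_isomorphic_refl.
  + by move=> x y z; exact: subgraph_isomorphic_trans.
  (* Monotonicity in both directions makes the sizes equal, and (S2) concludes. *)
  + move=> x y xy yx; apply: (strict _ _ xy).
    by apply/eqP; rewrite eq_le !mono.
- split=> // x; exact: size_GVE_ge0.
- move=> x1 x2.
  have [h hP] := exists_subgraph_empty (representative x1).
  have h_cs : common_subelements (@subclass _ SV SE) (pair_of x1 x2)
      (class_of (graph_of h)) by move=> y _; exact: subl.
  split; first by exists (class_of (graph_of h)).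
  (* A common subelement lies below [x1] in particular, so the representative of [x1] bounds all of
     them. *)
  apply: (size_has_maximum (alpha := alpha) (g := representative x1)).
    by exists (size_class alpha (class_of (graph_of h))), (class_of (graph_of h)).
  move=> r [x x_cs <-]; exists (representative x) => //.
  by apply: x_cs; left.
- move=> x1 x2 x le1 le2.
  have [g12 [g1 g2 hs]] := subgraph_isomorphic_intersection alpha_gt0 le1 le2.
  exists (class_of g12); first by move=> y [->|->]; exact: subl.
  by rewrite size_classE lerBlDr.
Qed.
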